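(* Let $G$ be a finite nilpotent group having a subgroup $N$ such that $(G,N)$ is an equal order pair. Then $G$ is a $p$-group for some prime $p$.
   Context: If $G$ is a finite group and $N$ is a proper, nontrivial, normal subgroup of $G$, the pair $(G,N)$ is called an equal order pair if, for every $x \in G \setminus N$, all elements of the coset $xN$ have the same order as $x$. *)

(* Defs.v *)
From mathcomp Require Import all_boot all_fingroup all_solvable.

Set Implicit Arguments.
Unset Strict Implicit.
Unset Printing Implicit Defensive.

Import GroupScope.

Definition equal_order_pair (gT : finGroupType) (G N : {group gT}) : Prop :=
  [/\ N <| G, N \proper G, N :!=: 1
    & forall x : gT, x \in G :\: N ->
      forall y : gT, y \in x *: N -> #[y] = #[x]].

(* Main.v *)
Require Import Defs.
From mathcomp Require Import all_boot all_fingroup all_solvable.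

Import GroupScope.

(** In a nilpotent group elements of coprime orders commute, so multiplying
    some [x] outside [N] by a nontrivial [n] in [N] of coprime order would
    change its order.  Taking [n] of prime order [q] forces the [q']-part of
    every element of [G] into [N]; hence the [q]-part of some [x] outside [N]
    is itself outside [N], and playing it against these [q']-parts shows that
    they are all trivial. *)

Lemma equal_order_pair_coprime (gT : finGroupType) (G N : {group gT})
    (x n : gT) :
  nilpotent G -> equal_order_pair G N -> x \in G :\: N -> n \in N ->
  coprime #[x] #[n] -> n = 1.
Proof.
move=> nilG [nNG _ _ eqo] xGN nN co_xn.
have [xG _] := setDP xGN.
have nG : n \in G := subsetP (normal_sub nNG) n nN.
have cxn : commute x n.
  (* Passing to [<[x]>] and [<[n]>]: subgroups of coprime orders in a nilpotent group centralize
     each other. *)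
  apply/cent1P; rewrite -cent_cycle -cycle_subG centsC.
  by rewrite (sub_nilpotent_cent2 nilG) ?cycle_subG.
have := eqo x xGN (x * n).
rewrite mem_lcoset mulKg nN orderM // => /(_ isT) /eqP.
by rewrite -{2}[#[x]]muln1 eqn_pmul2l ?order_gt0 // order_eq1 => /eqP.
Qed.

(** By Cauchy, each prime divisor of [#|G|] is the order of an element, hence equals [p]. *)
Lemma pgroup_p_elt (gT : finGroupType) (p : nat) (G : {group gT}) :
  (forall x, x \in G -> p.-elt x) -> p.-group G.
Proof.
move=> pG; apply/pgroupP=> r r_pr /(Cauchy r_pr)[x xG ox].
by move: (pG x xG); rewrite /p_elt ox pnatE.
Qed.

Theorem proposition3p1 (gT : finGroupType) (G : {group gT}) :
  nilpotent G ->
  (exists N : {group gT}, equal_order_pair G N) ->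
  exists p : nat, prime p /\ p.-group G.
Proof.
move=> nilG [N eopN]; have [_ prNG ntN _] := eopN.
have N_gt1 : 1 < #|N| by rewrite cardG_gt1.
set q := pdiv #|N|; have q_pr : prime q by apply: pdiv_prime.
have [n nN on] := Cauchy q_pr (pdiv_dvd _).
have q'N y : y \in G -> y.`_q^' \in N.
  move=> yG; apply: contraT => y'N.
  have n1 : n = 1.
    apply: (equal_order_pair_coprime _ G N y.`_q^') => //.
      by rewrite inE y'N groupX.
    rewrite on coprime_sym; apply: pnat_coprime (p_elt_constt _ _).
    exact: pnat_id.
  by move: q_pr; rewrite -on n1 order1.
have [_ [x xG xN]] := properP prNG.
have xqGN : x.`_q \in G :\: N.
  (* Otherwise [x], the product of its [q]-part and its [q^']-part, would lie in [N]. *)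
  rewrite inE (groupX _ xG) andbT; apply: contra xN => xqN.
  by rewrite -(consttC q x) groupM ?q'N.
exists q; split=> //; apply: pgroup_p_elt => y yG.
(* Once its [q^']-part is trivial, [y] equals its [q]-part. *)
rewrite -(consttC q y).
rewrite (equal_order_pair_coprime _ G N x.`_q y.`_q^') ?q'N //.
  by rewrite mulg1 p_elt_constt.
exact: pnat_coprime (p_elt_constt _ _) (p_elt_constt _ _).
Qed.
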